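(* Let $m>1$ and let $\Omega\subset\mathbb{R}^m$ be a (possibly unbounded) domain of class $C^0$. If $p,q\in\mathbb{S}^{m-1}$ are good directions at a point $P\in\mathbb{R}^m$ with respect to the ball $B(P,\delta)$, then $p\neq-q$ and for any $\lambda\in(0,1)$ the vector $$\frac{\lambda p+(1-\lambda)q}{|\lambda p+(1-\lambda)q|}$$ is a good direction at $P$ with respect to the ball $B(P,\delta)$.
   Context: A set $\Omega\subset\mathbb{R}^m$ is a domain of class $C^0$ if $\Omega$ is a (nonempty) connected open set such that for every $P\in\partial\Omega$ there exist $\delta>0$, an orthonormal coordinate system $y=(y',y_m)$ with origin at $P$, and a continuous function $f:\mathbb{R}^{m-1}\to\mathbb{R}$ such that $\Omega\cap B(P,\delta)=\{y\in\mathbb{R}^m:y_m>f(y'),\ |y|<\delta\}$. Good direction: for a point $P\in\mathbb{R}^m$ (not necessarily on $\partial\Omega$) and $\delta>0$ with $B(P,\delta)\cap\partial\Omega\neq\emptyset$, a vector $n\in\mathbb{S}^{m-1}$ is a good direction at $P$ with respect to the ball $B(P,\delta)$ if there are an orthonormal coordinate system $y=(y',y_m)$ with origin at $P$ such that $n=e_m$ is the unit vector in the $y_m$ direction, and a continuous function $f:\mathbb{R}^{m-1}\to\mathbb{R}$ (depending on $P,n,\delta$), such that $\Omega\cap B(P,\delta)=\{y\in\mathbb{R}^m:y_m>f(y'),\ |y|<\delta\}$. *)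

(* Defs.v *)
From mathcomp Require Import all_boot all_order all_algebra.
From mathcomp Require Import all_classical all_reals all_analysis.

Set Implicit Arguments.
Unset Strict Implicit.
Unset Printing Implicit Defensive.

Import Order.TTheory GRing.Theory Num.Theory.
Import numFieldNormedType.Exports.

Local Open Scope classical_set_scope.
Local Open Scope ring_scope.

Definition boundary (T : topologicalType) (A : set T) : set T :=
  closure A `\` interior A.

Section GoodDirections.
Variable R : realType.

(* The norm `|_| and the balls carried by 'rV[R]_n are those of the sup norm:
   they give the usual topology, but not the Euclidean balls needed here. *)
Definition enorm n (x : 'rV[R]_n) : R := Num.sqrt (\sum_i x 0 i ^+ 2).

Definition eball n (P : 'rV[R]_n) (delta : R) : set 'rV[R]_n :=
  [set x | enorm (x - P) < delta].

Definition esphere n : set 'rV[R]_n := [set x | enorm x = 1].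

(* An orthonormal basis of R^n is given by the matrix Q whose i-th row is the
   i-th basis vector, either orientation being allowed. *)
Definition orthonormal_basis n (Q : 'M[R]_n) : Prop := Q *m Q^T = 1%:M.

(* Coordinates of x in the system with origin P and axes the rows of Q:
   x = P + \sum_i (coords P Q x) 0 i *: row i Q when Q is orthonormal. *)
Definition coords n (P : 'rV[R]_n) (Q : 'M[R]_n) (x : 'rV[R]_n) : 'rV[R]_n :=
  (x - P) *m Q^T.

(* From here on the ambient dimension is k.+1; a coordinate vector y is split
   as (y', y_m) with y' = col' ord_max y and y_m = y 0 ord_max. *)
Definition is_epigraph_in_ball k (Omega : set 'rV[R]_k.+1) (P : 'rV[R]_k.+1)
    (delta : R) (Q : 'M[R]_k.+1) (f : 'rV[R]_k -> R) : Prop :=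
  Omega `&` eball P delta =
  [set x | let y := coords P Q x in
           f (col' ord_max y) < y 0 ord_max /\ enorm y < delta].

Definition C0_domain k (Omega : set 'rV[R]_k.+1) : Prop :=
  [/\ Omega !=set0, connected Omega, open Omega &
      forall P, boundary Omega P ->
        exists (delta : R) (Q : 'M[R]_k.+1) (f : 'rV[R]_k -> R),
          [/\ 0 < delta, orthonormal_basis Q, continuous f &
              is_epigraph_in_ball Omega P delta Q f]].

Definition good_direction k (Omega : set 'rV[R]_k.+1) (P : 'rV[R]_k.+1)
    (delta : R) (n : 'rV[R]_k.+1) : Prop :=
  [/\ 0 < delta,
      eball P delta `&` boundary Omega !=set0,
      esphere n &
      exists (Q : 'M[R]_k.+1) (f : 'rV[R]_k -> R),
        [/\ orthonormal_basis Q, row ord_max Q = n, continuous f &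
            is_epigraph_in_ball Omega P delta Q f]].

End GoodDirections.

(* Main.v *)
(* Call [p] upward if moving in direction [p] inside the ball leads from the
   closure of Omega into Omega. Good directions are upward, opposite directions
   cannot both be upward when the ball meets the boundary, and upward directions
   form a convex cone. Conversely an upward unit vector [n] is good: on each
   chord of the ball parallel to [n], Omega is an upper set; let the graph be the
   infimum of its parameters, or the top of the chord if Omega misses it. It is
   upper semicontinuous because Omega is open, lower semicontinuous because
   points below it stay away from the closure of Omega, and it extends
   continuously by 0 outside the ball since the chords shrink to points. *)

Require Import Defs.
From mathcomp Require Import all_boot all_order all_algebra.
From mathcomp Require Import all_classical all_reals all_analysis.
From mathcomp Require Import ring lra.

Import Order.TTheory GRing.Theory Num.Theory.
Import numFieldNormedType.Exports.

Local Open Scope classical_set_scope.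
Local Open Scope ring_scope.

(** * Euclidean norm: Cauchy-Schwarz, triangle inequality, continuity *)

Section EuclideanNorm.
Set Implicit Arguments.
Unset Strict Implicit.
Variable R : realType.

Definition dot n (x y : 'rV[R]_n) : R := (x *m y^T) 0 0.

Lemma enorm_ge0 n (x : 'rV[R]_n) : 0 <= enorm x.
Proof. exact: sqrtr_ge0. Qed.

Lemma sqr_enorm n (x : 'rV[R]_n) : enorm x ^+ 2 = dot x x.
Proof.
rewrite /enorm sqr_sqrtr; last by rewrite sumr_ge0// => i _; exact: sqr_ge0.
by rewrite /dot !mxE; apply: eq_bigr => i _; rewrite mxE expr2.
Qed.

Lemma dotC n (x y : 'rV[R]_n) : dot x y = dot y x.
Proof.
by rewrite /dot !mxE; apply: eq_bigr => i _; rewrite !mxE mulrC.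
Qed.

Lemma dotDl n (x y z : 'rV[R]_n) : dot (x + y) z = dot x z + dot y z.
Proof. by rewrite /dot mulmxDl mxE. Qed.

Lemma dotZl n a (x z : 'rV[R]_n) : dot (a *: x) z = a * dot x z.
Proof. by rewrite /dot -scalemxAl mxE. Qed.

Lemma dotDr n (x y z : 'rV[R]_n) : dot z (x + y) = dot z x + dot z y.
Proof. by rewrite !(dotC z) dotDl. Qed.

Lemma dotZr n a (x z : 'rV[R]_n) : dot z (a *: x) = a * dot z x.
Proof. by rewrite !(dotC z) dotZl. Qed.

Lemma enormZ n a (x : 'rV[R]_n) : enorm (a *: x) = `|a| * enorm x.
Proof.
apply/eqP; rewrite -(@eqrXn2 _ 2%N)// ?mulr_ge0 ?enorm_ge0//.
by rewrite exprMn !sqr_enorm dotZl dotZr real_normK ?num_real// mulrA expr2.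
Qed.

Lemma enorm0_eq0 n (x : 'rV[R]_n) : enorm x = 0 -> x = 0.
Proof.
move=> x0; have := sqr_enorm x; rewrite x0 expr0n/= /dot mxE => /esym/eqP.
rewrite psumr_eq0; last by move=> i _; rewrite mxE -expr2 sqr_ge0.
move=> /allP xi0; apply/rowP => i; apply/eqP; rewrite mxE.
by have := xi0 i (mem_index_enum i); rewrite mxE -expr2 sqrf_eq0.
Qed.

(** Cauchy-Schwarz: for nonzero vectors, expand the square of the norm of
    [enorm y *: x - enorm x *: y] and divide by [enorm x * enorm y]. *)
Lemma dot_le_enorm n (x y : 'rV[R]_n) : dot x y <= enorm x * enorm y.
Proof.
have := enorm_ge0 x; rewrite le_eqVlt => /predU1P[/esym/enorm0_eq0 ->|x0].
  by rewrite /dot mul0mx mxE mulr_ge0 ?enorm_ge0.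
have := enorm_ge0 y; rewrite le_eqVlt => /predU1P[/esym/enorm0_eq0 ->|y0].
  by rewrite /dot trmx0 mulmx0 mxE mulr_ge0 ?enorm_ge0.
have := sqr_ge0 (enorm (enorm y *: x + (- enorm x) *: y)).
rewrite sqr_enorm !(dotDl, dotDr, dotZl, dotZr) -!sqr_enorm (dotC y x).
move=> h; rewrite -subr_ge0 -(pmulr_rge0 _ (mulr_gt0 x0 y0)); nra.
Qed.

Lemma enormD n (x y : 'rV[R]_n) : enorm (x + y) <= enorm x + enorm y.
Proof.
rewrite -(@ler_pXn2r _ 2%N) ?nnegrE ?addr_ge0 ?enorm_ge0//.
rewrite sqr_enorm !(dotDl, dotDr) -!sqr_enorm (dotC y x).
have := dot_le_enorm x y; nra.
Qed.

(** A basic neighbourhood of a matrix is a finite family of neighbourhoods of its entries, and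
    finite intersections of neighbourhoods are neighbourhoods. *)
Lemma continuous_mx (T : topologicalType) m n (f : T -> 'M[R]_(m, n)) :
  (forall i j, continuous (fun x => f x i j)) -> continuous f.
Proof.
move=> cf x A [B fxB BA].
have : \forall z \near x, forall ij, B ij.1 ij.2 (f z ij.1 ij.2).
  by apply: filter_forall => -[i j]; exact: cf.
by apply: filterS => z Bz; apply: BA => i j; exact: (Bz (i, j)).
Qed.

Lemma continuous_mulmxr (m n p : nat) (A : 'M[R]_(n, p)) :
  continuous (fun x : 'M[R]_(m, n) => x *m A).
Proof.
apply: continuous_mx => i j.
under [X in continuous X]eq_fun do rewrite mxE.
apply: continuous_big => [|l _ x]; first exact: add_continuous.
exact: (cvgM (@coord_continuous R m n i l x) (cvg_cst (A l j))).
Qed.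

Lemma continuous_enorm n : continuous (@enorm R n).
Proof.
move=> x; apply: (continuous_comp _ (@sqrt_continuous R _)).
apply: continuous_big => [|l _ z]; first exact: add_continuous.
exact: (continuous_comp (@coord_continuous R 1 n 0 l z) (@exprn_continuous R 2 _)).
Qed.

Lemma continuous_mxD (T : topologicalType) m n (f g : T -> 'M[R]_(m, n)) :
  continuous f -> continuous g -> continuous (fun x => f x + g x).
Proof.
move=> cf cg; apply: continuous_mx => i j x.
under [X in continuous_at _ X]eq_fun do rewrite mxE.
exact: (cvgD (continuous_comp (cf x) (@coord_continuous R m n i j _))
             (continuous_comp (cg x) (@coord_continuous R m n i j _))).
Qed.

Lemma continuous_coords k (P : 'rV[R]_k) (Q : 'M[R]_k) :
  continuous (coords P Q).
Proof.
have cB : continuous (fun x : 'rV[R]_k => x - P).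
  by apply: continuous_mxD => x; [exact: cvg_id|exact: cst_continuous].
by move=> x; exact: (continuous_comp (cB x) (@continuous_mulmxr _ _ _ Q^T _)).
Qed.

Lemma continuous_col' m n i : continuous (@col' R m n i).
Proof.
apply: continuous_mx => a b.
under [X in continuous X]eq_fun do rewrite mxE.
exact: coord_continuous.
Qed.

Lemma continuous_line n (x w : 'rV[R]_n) :
  continuous (fun t : R => x + t *: w).
Proof.
apply: continuous_mxD => [|]; first exact: cst_continuous.
apply: continuous_mx => i j t.
under [X in continuous_at _ X]eq_fun do rewrite mxE.
exact: (@mulrr_continuous R (w i j)).
Qed.
End EuclideanNorm.

(** * Upward directions and their convex cone *)

Section Upward.
Set Implicit Arguments.
Unset Strict Implicit.
Variables (R : realType) (k : nat) (Omega : set 'rV[R]_k.+1).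
Variables (P : 'rV[R]_k.+1) (delta : R).

Definition upward (p : 'rV[R]_k.+1) := forall (x : 'rV[R]_k.+1) (t : R),
  closure Omega x -> eball P delta x -> 0 < t ->
  eball P delta (x + t *: p) -> Omega (x + t *: p).

Lemma open_eball : open (eball P delta).
Proof.
have cB : continuous (fun x : 'rV[R]_k.+1 => x - P).
  by apply: continuous_mxD => x; [exact: cvg_id|exact: cst_continuous].
have cE : continuous (fun x : 'rV[R]_k.+1 => enorm (x - P)).
  by move=> x; exact: (continuous_comp (cB x) (@continuous_enorm R _ _)).
exact: (open_comp (fun x _ => cE x) (@open_lt R delta)).
Qed.

Lemma enorm_coords (Q : 'M[R]_k.+1) x :
  orthonormal_basis Q -> enorm (coords P Q x) = enorm (x - P).
Proof.
move=> oQ; apply/eqP; rewrite -(@eqrXn2 _ 2%N) ?enorm_ge0// !sqr_enorm.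
rewrite /dot /coords trmx_mul trmxK mulmxA -(mulmxA (x - P)).
by rewrite (mulmx1C oQ) mulmx1.
Qed.

Lemma coordsD (Q : 'M[R]_k.+1) x t : orthonormal_basis Q ->
  coords P Q (x + t *: row ord_max Q) = coords P Q x + t *: delta_mx 0 ord_max.
Proof.
move=> oQ; rewrite /coords addrAC mulmxDl -scalemxAl -row_mul.
by rewrite (oQ : Q *m Q^T = 1%:M) row1.
Qed.

Lemma good_direction_upward p : good_direction Omega P delta p -> upward p.
Proof.
case=> _ _ _ [Q [f [oQ <- cf epi]]] x t clx Bx t0 Bxt.
set y := coords P Q x.
(* Otherwise the strict reverse inequality would hold near [x], where closure supplies points of
   [Omega] in the ball, all above the graph. *)
have fy : f (col' ord_max y) <= y 0 ord_max.
  rewrite leNgt; apply/negP => yf.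
  have cy : continuous_at x (coords P Q) by exact: continuous_coords.
  have c1 : continuous_at x (col' ord_max \o coords P Q).
    exact: (continuous_comp cy (@continuous_col' R _ _ ord_max _)).
  have c2 := continuous_comp c1 (cf _).
  have c3 := continuous_comp cy (@coord_continuous R _ _ 0 ord_max _).
  have cF := continuousB c2 c3.
  have F0 : 0 < f (col' ord_max y) - y 0 ord_max by rewrite subr_gt0.
  have nF : \forall z \near x,
      0 < f (col' ord_max (coords P Q z)) - coords P Q z 0 ord_max.
    exact: (cvgr_gt _ cF _ F0).
  have nB : nbhs x (eball P delta) by apply: open_nbhs_nbhs; split=> //; exact: open_eball.
  have [z [Oz [/= Fz Bz]]] := clx _ (filterI nF nB).
  have : (Omega `&` eball P delta) z by [].
  by rewrite epi => -[/=]; rewrite -subr_lt0 => /lt_trans /(_ Fz); rewrite ltxx.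
suff : (Omega `&` eball P delta) (x + t *: row ord_max Q) by case.
rewrite epi /= enorm_coords//; split; last exact: Bxt.
rewrite coordsD// -/y; clearbody y; rewrite !mxE !eqxx/= mulr1.
have -> : col' ord_max (y + t *: delta_mx 0 ord_max) = col' ord_max y.
  by apply/rowP => i; rewrite !mxE eqxx/= eq_sym (negbTE (neq_lift _ _)) mulr0 addr0.
by rewrite (le_lt_trans fy)// ltrDl.
Qed.

Lemma eball_step x w t : 0 <= t -> enorm (x - P) + t * enorm w < delta ->
  eball P delta (x + t *: w).
Proof.
move=> t0; apply: le_lt_trans; rewrite addrAC.
by rewrite (le_trans (enormD _ _))// enormZ (ger0_norm t0).
Qed.

(** From a boundary point [x], a short step along [p] enters [Omega]; stepping back along [- p] puts
    [x] itself in the open set [Omega]. *)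
Lemma upwardN p : open Omega -> eball P delta `&` boundary Omega !=set0 ->
  upward p -> upward (- p) -> False.
Proof.
move=> oO [x [Bx [clx]]]; rewrite (interior_id _).1// => nOx up uN.
set e := delta - enorm (x - P).
have e0 : 0 < e by rewrite subr_gt0.
have d0 : 0 < enorm p + 1 by rewrite ltr_wpDl// enorm_ge0.
(* This gives [t * enorm p < e]; the added 1 keeps the denominator positive. *)
set t := e / (enorm p + 1).
have t0 : 0 < t by rewrite divr_gt0.
have Bt : eball P delta (x + t *: p).
  apply: eball_step; first exact: ltW.
  rewrite -ltrBrDl -/e /t mulrAC ltr_pdivrMr// ltr_pM2l// ltrDl//.
apply: nOx; rewrite -(addrK (t *: p) x) -scalerN; apply: uN => //.
- by apply: subset_closure; exact: up.
- by rewrite scalerN addrK.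
Qed.

Lemma upwardZ a p : 0 < a -> upward p -> upward (a *: p).
Proof.
by move=> a0 up x t; rewrite scalerA => clx Bx t0 Bxt; apply: up; rewrite ?mulr_gt0.
Qed.

(** The point is a convex combination of the ends of the segment. Bounding by the maximum keeps the
    whole segment uniformly away from the sphere. *)
Lemma enorm_convex x w c : 0 <= c <= 1 ->
  enorm (x + c *: w - P) <= Num.max (enorm (x - P)) (enorm (x + w - P)).
Proof.
move=> /andP[c0 c1].
have -> : x + c *: w - P = (1 - c) *: (x - P) + c *: (x + w - P).
  rewrite !(scalerBr, scalerDr) !scalerBl !scale1r !opprB.
  by apply/rowP => i; rewrite !mxE; ring.
apply: (le_trans (enormD _ _)); rewrite !enormZ !ger0_norm ?subr_ge0//.
set M := Num.max _ _.
have h1 : enorm (x - P) <= M by rewrite le_max lexx.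
have h2 : enorm (x + w - P) <= M by rewrite le_max lexx orbT.
nra.
Qed.

(* The segment from [x] to [x + t (p + q)] is compact in the ball, so for a fine
   enough subdivision the detour [z, z + s p, z + s p + s q] stays in the ball. *)
Lemma upwardD p q : upward p -> upward q -> upward (p + q).
Proof.
move=> up uq x t clx Bx t0 Bxt.
set r := Num.max (enorm (x - P)) (enorm (x + t *: (p + q) - P)).
have rd : r < delta by rewrite gt_max; apply/andP.
have seg c : 0 <= c <= 1 -> enorm (x + (c * t) *: (p + q) - P) <= r.
  by rewrite -scalerA; exact: enorm_convex.
have tp0 : 0 <= t * enorm p / (delta - r).
  by rewrite divr_ge0 ?mulr_ge0 ?enorm_ge0 ?subr_ge0// ltW.
(* With [N.+1] steps of length parameter [s = t / N.+1], one gets [s * enorm p < delta - r]. *)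
have [N NE] : exists N : nat, t * enorm p / (delta - r) < N.+1%:R.
  by exists (Num.truncn (t * enorm p / (delta - r))); exact: truncnS_gt.
have N0 : 0 < N.+1%:R :> R by [].
pose z (j : nat) := x + (j%:R / N.+1%:R * t) *: (p + q).
have zB j : (j <= N.+1)%N -> enorm (z j - P) <= r.
  by move=> jN; apply: seg; rewrite divr_ge0//= ler_pdivrMr// mul1r ler_nat.
(* Only closure is assumed of [z j], since the start [z 0 = x] may lie on the boundary; the step
   from [N] reaches the target [z N.+1]. *)
have step j : (j <= N)%N -> closure Omega (z j) -> Omega (z j.+1).
  move=> jN clz; set s := t / N.+1%:R.
  have s0 : 0 < s by rewrite divr_gt0.
  have zS : z j.+1 = z j + s *: p + s *: q.
    rewrite /z -!addrA -scalerDr -scalerDl -natr1; congr (_ + _ *: _).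
    by rewrite /s; field; rewrite lt0r_neq0.
  have Bsp : eball P delta (z j + s *: p).
    apply: eball_step; first exact: ltW.
    have := zB j (leqW jN).
    have : s * enorm p < delta - r.
      by rewrite /s mulrAC ltr_pdivrMr// [ltRHS]mulrC -ltr_pdivrMr// subr_gt0.
    lra.
  rewrite zS; apply: uq => //.
    apply: subset_closure; apply: up => //.
    exact: le_lt_trans (zB j (leqW jN)) rd.
  rewrite -zS; exact: le_lt_trans (zB j.+1 jN) rd.
have clz j : (j <= N)%N -> closure Omega (z j).
  elim: j => [_|j IH jN]; first by rewrite /z mul0r mul0r scale0r addr0.
  by apply: subset_closure; apply: step; [exact: ltnW|exact/IH/ltnW].
have := step N (leqnn N) (clz N (leqnn N)).
by rewrite /z divff ?mul1r// lt0r_neq0.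
Qed.
End Upward.

(** * Orthonormal frames and splitting off the last coordinate *)

Section Graph.
Set Implicit Arguments.
Unset Strict Implicit.
Variable R : realType.

(* The Householder reflection exchanging [n] and the last basis vector. *)
Lemma orthonormal_basis_last_row k (n : 'rV[R]_k.+1) : enorm n = 1 ->
  exists Q, orthonormal_basis Q /\ row ord_max Q = n.
Proof.
move=> n1; set e : 'rV[R]_k.+1 := delta_mx 0 ord_max.
have [->|ne] := eqVneq n e.
  by exists 1%:M; rewrite row1 /orthonormal_basis trmx1 mulmx1.
have de x : dot e x = x 0 ord_max by rewrite /dot -rowE !mxE.
have ee : dot e e = 1 by rewrite de mxE !eqxx.
pose w := n - e; pose d := dot w w.
have wE : w = n + (-1) *: e by rewrite scaleN1r.
have dE : d = 2 - 2 * dot e n.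
  rewrite /d wE !(dotDl, dotDr, dotZl, dotZr) -sqr_enorm n1 ee (dotC n e).
  by ring.
have d0 : d != 0.
  apply: contra_neq ne => d0; apply/eqP; rewrite -subr_eq0; apply/eqP.
  by apply: enorm0_eq0; apply/eqP; rewrite -sqrf_eq0 sqr_enorm -/w -/d d0.
have wwT : w *m w^T = d%:M by rewrite [LHS]mx11_scalar.
clearbody d w; pose H := 1%:M - (2 / d) *: (w^T *m w).
have HT : H^T = H by rewrite /H linearB/= linearZ/= trmx1 trmx_mul trmxK.
exists H; split.
  (* As [H] is symmetric and [w *m w^T = d], the quadratic term of [H *m H] is [4 / d] times
     [w^T *m w] and cancels the two linear terms. *)
  rewrite /orthonormal_basis HT /H mulmxBl mul1mx mulmxBr mulmx1.
  rewrite -scalemxAl -scalemxAr mulmxA -(mulmxA _ w) wwT mul_mx_scalar.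
  rewrite -scalemxAl !scalerA divfK//.
  by rewrite mulr_natr mulr2n scalerDl opprB addrK subrK.
rewrite rowE -/e /H mulmxBr mulmx1 -scalemxAr mulmxA.
have -> : e *m w^T = (dot e w)%:M by rewrite [LHS]mx11_scalar.
rewrite mul_scalar_mx scalerA.
(* Both vectors are unit, so [dot e w = dot e n - 1 = - d / 2]. *)
have -> : 2 / d * dot e w = -1.
  rewrite wE dotDr dotZr ee; move: d0; rewrite dE => d0; field.
  by apply: contra_neq d0; lra.
by rewrite scaleN1r opprK wE scaleN1r addrC subrK.
Qed.

Definition row_snoc k (y : 'rV[R]_k) (t : R) : 'rV[R]_k.+1 :=
  \row_i if unlift ord_max i is Some j then y 0 j else t.

Lemma row_snoc_last k (y : 'rV[R]_k) t : row_snoc y t 0 ord_max = t.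
Proof. by rewrite mxE unlift_none. Qed.

Lemma row_snoc_lift k (y : 'rV[R]_k) t i : row_snoc y t 0 (lift ord_max i) = y 0 i.
Proof. by rewrite mxE liftK. Qed.

Lemma row_snocK k (x : 'rV[R]_k.+1) : row_snoc (col' ord_max x) (x 0 ord_max) = x.
Proof.
by apply/rowP => i; case: (unliftP ord_max i) => [j|] ->;
  rewrite ?row_snoc_lift ?row_snoc_last ?mxE.
Qed.

Lemma sqr_enorm_row_snoc k (y : 'rV[R]_k) t :
  enorm (row_snoc y t) ^+ 2 = enorm y ^+ 2 + t ^+ 2.
Proof.
rewrite !sqr_enorm /dot !mxE big_ord_recr/= !mxE unlift_none expr2.
congr (_ + _); apply: eq_bigr => i _.
have -> : widen_ord (leqnSn k) i = lift ord_max i.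
  by apply: val_inj; rewrite /= /bump leqNgt ltn_ord.
by rewrite !mxE liftK.
Qed.

Lemma continuous_row_snoc k t : continuous (fun y : 'rV[R]_k => row_snoc y t).
Proof.
apply: continuous_mx => i j; under [X in continuous X]eq_fun do rewrite mxE.
case: (unliftP ord_max j) => [l _|_]; first exact: coord_continuous.
exact: cst_continuous.
Qed.

(** * The continuous graph attached to an upward direction *)

Variables (k : nat) (Omega : set 'rV[R]_k.+1) (P : 'rV[R]_k.+1) (delta : R).
Variable Q : 'M[R]_k.+1.
Hypotheses (oQ : orthonormal_basis Q) (delta0 : 0 < delta) (oO : open Omega).
Hypothesis up : upward Omega P delta (row ord_max Q).

Let point y t := P + row_snoc y t *m Q.

Let pointD y (t s : R) : point y (t + s) = point y t + s *: row ord_max Q.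
Proof.
rewrite /point rowE scalemxAl -addrA -mulmxDl; congr (_ + _ *m _).
apply/rowP => i; case: (unliftP ord_max i) => [j|] ->.
  by rewrite !(mxE, liftK) eqxx eq_sym (negbTE (neq_lift _ _)) mulr0 addr0.
by rewrite !(mxE, unlift_none) !eqxx mulr1.
Qed.

Let coordsK x : point (col' ord_max (coords P Q x)) (coords P Q x 0 ord_max) = x.
Proof.
rewrite /point row_snocK /coords -mulmxA.
by rewrite (mulmx1C (oQ : Q *m Q^T = 1%:M)) mulmx1 addrC subrK.
Qed.

(* [height y] is half the length of the chord over [y] (0 when [y] is outside,
   since [Num.sqrt] vanishes on negative numbers). *)
Let height (y : 'rV[R]_k) := Num.sqrt (delta ^+ 2 - enorm y ^+ 2).

(** Pythagoras. In the converse, [height y] exceeds an absolute value, so it is positive and the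
    default value of [Num.sqrt] does not interfere. *)
Let lt_height y (t : R) : enorm (row_snoc y t) < delta <-> `|t| < height y.
Proof.
have <- : (enorm (row_snoc y t) ^+ 2 < delta ^+ 2) = (enorm (row_snoc y t) < delta).
  by rewrite ltr_pXn2r// nnegrE ?enorm_ge0 ?ltW.
rewrite sqr_enorm_row_snoc -ltrBrDl -[`|t|]ger0_norm// -sqrtr_sqr real_normK ?num_real//.
split=> [h|]; first by rewrite ltr_sqrt// (le_lt_trans (sqr_ge0 t)).
rewrite /height => h; rewrite -ltr_sqrt// -sqrtr_gt0.
exact: le_lt_trans (sqrtr_ge0 _) h.
Qed.

Let eball_point y (t : R) : eball P delta (point y t) <-> `|t| < height y.
Proof.
rewrite -lt_height /eball /= -(enorm_coords P _ oQ) /coords /point.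
by rewrite addrAC subrr add0r -mulmxA (oQ : Q *m Q^T = 1%:M) mulmx1.
Qed.

Let continuous_height : continuous height.
Proof.
move=> y; have c2 := continuous_comp (@continuous_enorm R k y)
  (@exprn_continuous R 2 _).
have c1 : continuous_at y (fun=> delta ^+ 2) by exact: cst_continuous.
exact: (continuous_comp (continuousB c1 c2) (@sqrt_continuous R _)).
Qed.

(** Including the top [height y] makes the set nonempty, so that its infimum is meaningful; off the
    ball the set is just 0. *)
Let heights y := [set t : R | t = height y \/ `|t| < height y /\ Omega (point y t)].
Let graph y := inf (heights y).

Let heights_lb y : lbound (heights y) (- height y).
Proof.
move=> t [->|[+ _]]; first by rewrite -subr_ge0 opprK addr_ge0 ?sqrtr_ge0.
by rewrite ltr_norml => /andP[/ltW].
Qed.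

Let graph_le y (t : R) : heights y t -> graph y <= t.
Proof. by move=> ht; apply: ge_inf => //; exists (- height y). Qed.

Let heights_up y (t s : R) : `|t| < height y -> `|s| < height y -> t < s ->
  closure Omega (point y t) -> Omega (point y s).
Proof.
move=> th sh ts clt; have sE : s = t + (s - t) by rewrite addrC subrK.
rewrite sE pointD; apply: up => //; [exact/eball_point|by rewrite subr_gt0|].
by rewrite -pointD -sE; exact/eball_point.
Qed.

Let continuous_point t : continuous (fun y => point y t).
Proof.
apply: continuous_mxD; first exact: cst_continuous.
by move=> y; exact: (continuous_comp (@continuous_row_snoc _ t y)
  (@continuous_mulmxr R _ _ _ Q _)).
Qed.

Let near_height y (t : R) : `|t| < height y -> \forall z \near y, `|t| < height z.
Proof. by move=> th; apply: (cvgr_gt _ (@continuous_height y)). Qed.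

(** Upper semicontinuity: some element of [heights y] lies below [c], and it persists nearby, by
    continuity of [height] if it is the top and by openness of [Omega] otherwise. *)
Let graph_lt_near y (c : R) : graph y < c -> \forall z \near y, graph z < c.
Proof.
move=> /inf_lt[|t [->|[th Ot]] tc]; first by exists (height y); left.
  have : \forall z \near y, height z < c.
    by apply: (cvgr_lt _ (@continuous_height y)).
  apply: filterS => z; apply: le_lt_trans; apply: graph_le; by left.
have Oz : \forall z \near y, Omega (point z t).
  by apply: continuous_point; exact: open_nbhs_nbhs.
apply: filterS2 (near_height th) Oz => z thz Oz.
by apply: le_lt_trans tc; apply: graph_le; right.
Qed.

Let graph_gt_near y (c : R) : c < graph y -> \forall z \near y, c < graph z.
Proof.
move=> cg; have gh : graph y <= height y by apply: graph_le; left.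
have hg : - height y <= graph y.
  by apply: lb_le_inf => //; exists (height y); left.
(* If [c] is below the bottom of the chord, the lower bound [- height z] suffices; this also covers
   [y] outside the closed ball. *)
have [cNh|Nhc] := ltP c (- height y).
  have : \forall z \near y, height z < - c.
    by apply: (cvgr_lt _ (@continuous_height y)); rewrite ltrNr.
  apply: filterS => z hz; rewrite ltrNr in hz.
  by apply: (lt_le_trans hz); apply: lb_le_inf => //; exists (height z); left.
have [t /andP[ct tg]] : exists t, c < t < graph y.
  by exists ((c + graph y) / 2); apply/andP; split; lra.
have th : `|t| < height y by rewrite ltr_norml; apply/andP; split; lra.
(* A closure point at [t] would put in [Omega] every higher point of the chord, including some still
   below the infimum. *)
have nOt : ~ closure Omega (point y t).
  move=> clt; have [s /andP[ts sg]] : exists s, t < s < graph y.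
    by exists ((t + graph y) / 2); apply/andP; split; lra.
  have sh : `|s| < height y by rewrite ltr_norml; apply/andP; split; lra.
  by have := graph_le (or_intror (conj sh (heights_up th sh ts clt))); lra.
have Oz : \forall z \near y, ~ Omega (point z t).
  have nC : nbhs (point y t) (~` closure Omega).
    apply: open_nbhs_nbhs; split=> //.
    by apply: closed_openC; exact: closed_closure.
  have : \forall z \near y, (~` closure Omega) (point z t).
    exact: continuous_point nC.
  by apply: filterS => z nz Oz; apply: nz; exact: subset_closure.
apply: filterS2 (near_height th) Oz => z thz Oz; apply: (lt_le_trans ct).
apply: lb_le_inf => [|s [->|[sh Os]]]; first by exists (height z); left.
  by rewrite ltW// (le_lt_trans (ler_norm t)).
(* A point of [Omega] at a level [s] below [t] would force the point at [t] into [Omega]. *)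
rewrite leNgt; apply/negP => st; apply: Oz.
by apply: (heights_up sh thz st); exact: subset_closure.
Qed.

Let continuous_graph : continuous graph.
Proof.
move=> y A /nbhs_ballP[e /= e0 eA].
have hi : \forall z \near y, graph z < graph y + e.
  by apply: graph_lt_near; rewrite ltrDl.
have lo : \forall z \near y, graph y - e < graph z.
  by apply: graph_gt_near; rewrite ltrBlDr ltrDl.
apply: filterS2 hi lo => z hi lo; apply: eA.
by rewrite /ball/= ltr_norml; apply/andP; split; lra.
Qed.

Lemma upward_epigraph : exists2 f : 'rV[R]_k -> R,
  continuous f & is_epigraph_in_ball Omega P delta Q f.
Proof.
exists graph; first exact: continuous_graph.
apply/seteqP; split=> x; rewrite /= (enorm_coords P _ oQ).
  move: (coordsK x); set y := col' _ _; set s := coords P Q x 0 _ => <- [Ox Bx].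
  split=> //; have sh : `|s| < height y by exact/eball_point.
  have : \forall r \near (0 : R), Omega (point y s + r *: row ord_max Q).
    apply: (@continuous_line R _ (point y s) (row ord_max Q) 0).
    by rewrite scale0r addr0; exact: open_nbhs_nbhs.
  move=> /nbhs_ballP[e /= e0 eO].
  (* The epigraph is strict, so a point of [Omega] slightly lower on the same chord is needed. *)
  have [t ts [th Ot]] :
      exists2 t, t < s & `|t| < height y /\ Omega (point y t).
    (* Half the minimum keeps [s - r] both within [e] of [s] and inside the chord. *)
    pose r := Num.min e (height y - `|s|) / 2.
    have m0 : 0 < Num.min e (height y - `|s|) by rewrite lt_min e0 subr_gt0.
    have [me mh] : Num.min e (height y - `|s|) <= e /\
        Num.min e (height y - `|s|) <= height y - `|s|.
      by split; rewrite ge_min lexx ?orbT.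
    have r0 : 0 < r by rewrite divr_gt0.
    exists (s + (- r)); first by rewrite gtrDl oppr_lt0.
    split; last first.
      rewrite pointD; apply: eO.
      by rewrite /ball/= sub0r opprK gtr0_norm// /r; lra.
    rewrite (le_lt_trans (ler_normD _ _))// normrN (gtr0_norm r0) /r; lra.
  by apply: le_lt_trans ts; apply: graph_le; right.
move: (coordsK x); set y := col' _ _; set s := coords P Q x 0 _ => <- [gs Bx].
split=> //; have sh : `|s| < height y by exact/eball_point.
(* The element of [heights y] below [s] cannot be the top, as [s] is interior to the chord. *)
have [|t [->|[th Ot]] ts] := inf_lt _ gs; first by exists (height y); left.
  by have := ler_norm s; lra.
by apply: (heights_up th sh ts); exact: subset_closure.
Qed.
End Graph.

(** * Convexity of the set of good directions *)

Theorem lemma2p1 (R : realType) (k : nat) (m_gt1 : (1 < k.+1)%N)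
    (Omega : set 'rV[R]_k.+1) (Omega_C0 : C0_domain Omega)
    (P : 'rV[R]_k.+1) (delta : R) (p q : 'rV[R]_k.+1)
    (p_good : good_direction Omega P delta p)
    (q_good : good_direction Omega P delta q) :
  p <> - q /\
  forall lambda : R, 0 < lambda < 1 ->
    let v := lambda *: p + (1 - lambda) *: q in
    good_direction Omega P delta ((enorm v)^-1 *: v).
Proof.
have [_ _ oO _] := Omega_C0.
have [d0 bd p1 _] := p_good; have [_ _ q1 _] := q_good.
have up := good_direction_upward p_good; have uq := good_direction_upward q_good.
have pNq : p <> - q.
  by move=> pE; apply: (upwardN oO bd uq); rewrite -pE.
split=> // lambda /andP[l0 l1] v.
have l2 : 0 < 1 - lambda by rewrite subr_gt0.
have uv : upward Omega P delta v by apply: upwardD; exact: upwardZ.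
(* If [v] vanished, comparing norms would give [lambda = 1 - lambda], hence [p = - q]. *)
have v0 : 0 < enorm v.
  rewrite lt0r enorm_ge0 andbT; apply/eqP => /enorm0_eq0 ve.
  have lE : lambda *: p = - ((1 - lambda) *: q) by apply/eqP; rewrite -addr_eq0 -/v ve.
  have : enorm (lambda *: p) = enorm ((1 - lambda) *: q).
    by rewrite lE -scaleN1r enormZ normrN1 mul1r.
  rewrite !enormZ (p1 : enorm p = 1) (q1 : enorm q = 1) !mulr1 !gtr0_norm// => lE'.
  apply: pNq; apply: (scalerI (lt0r_neq0 l0)).
  by rewrite lE -lE' scalerN.
set n := (enorm v)^-1 *: v.
have n1 : enorm n = 1.
  by rewrite enormZ gtr0_norm ?invr_gt0// mulVf// lt0r_neq0.
have un : upward Omega P delta n by apply: upwardZ; rewrite ?invr_gt0.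
have [Q [oQ Qn]] := orthonormal_basis_last_row n1.
rewrite -Qn in un; have [f cf ef] := upward_epigraph oQ d0 oO un.
by split=> //; exists Q, f.
Qed.
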